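(* Let $n\ge 1$ and let $\mathcal{A}=\{H_1,\dots,H_d\}$ be an affine essential hyperplane arrangement in $\mathbb{C}^{n+1}$ with $H_i=\{\ell_i=0\}$, $\deg \ell_i=1$. Put $X=\bigcup_i H_i$, $f=\prod_{i=1}^d \ell_i$, and for a tuple $e=(e_1,\dots,e_d)$ of positive integers with $\gcd(e_1,\dots,e_d)=1$ put $f_e=\prod_{i=1}^d \ell_i^{e_i}$ and $d_e=e_1+\dots+e_d$. Then the following hold. (i) If $n=1$, the polynomial $f$ is $M$-tame. (ii) If $n>1$, or if $n=1$ and $d_e>d$, the polynomial $f_e$ is $M_0$-tame in the following sense: for any sequence $\{z^k\}\subset M(f_e)\setminus X$ with $\lim_{k}|z^k|=+\infty$ one has $\lim_k |f_e(z^k)|=+\infty$.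
   Context: An affine hyperplane arrangement is a finite set of distinct affine hyperplanes; it is essential in $\mathbb{C}^{n+1}$ if some of its hyperplanes intersect in exactly one point (equivalently, the linear parts of the $\ell_i$ span the dual space of $\mathbb{C}^{n+1}$). For a polynomial $g\in\mathbb{C}[x_0,\dots,x_n]$ let $\mathrm{grad}(g)(x)=(g_0(x),\dots,g_n(x))$, where $g_k=\partial g/\partial x_k$, and set $$M(g)=\{x\in\mathbb{C}^{n+1} \mid \mathrm{grad}(g)(x)=c\,\overline{x}\ \text{ for some } c\in\mathbb{C}\},$$ where $\overline{x}$ is the complex conjugate of $x$. The polynomial $g$ is called $M$-tame if for any sequence $\{z^k\}\subset M(g)$ with $\lim|z^k|=+\infty$ one has $\lim|g(z^k)|=+\infty$. *)

(* Defs.v *)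
From HB Require Import structures.
From mathcomp Require Import all_boot all_order all_algebra.
From mathcomp Require Import complex.
From mathcomp Require Import boolp classical_sets reals topology normedtype.
From mathcomp Require Import -(notations) mpoly. (* notations clash with topology *)

Set Implicit Arguments.
Unset Strict Implicit.
Unset Printing Implicit Defensive.

Import Order.TTheory GRing.Theory Num.Theory.
Import numFieldNormedType.Exports.

Local Open Scope classical_set_scope.
Local Open Scope ring_scope.
Local Open Scope complex_scope.

Notation "{ 'mpoly' T [ n ] }" := (mpoly.mpoly n T).

(* Real-valued, unlike the norm of the numFieldType R[i]. *)
Definition cabs (R : realType) (z : R[i]) : R := Normc.normc z.

(* Euclidean norm; the library norm on row vectors is the max norm. *)
Definition enorm (R : realType) (m : nat) (x : 'rV[R[i]]_m) : R :=
  Num.sqrt (\sum_(j < m) cabs (x 0 j) ^+ 2).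

Definition pval (R : realType) (m : nat) (g : {mpoly R[i][m]})
  (x : 'rV[R[i]]_m) : R[i] := meval (x 0) g.

Definition zero_locus (R : realType) (m : nat) (g : {mpoly R[i][m]}) :
  set 'rV[R[i]]_m := [set x | pval g x = 0].

(* The hyperplanes of the arrangement are the zero loci of the l i; msize is
   1 + total degree. *)
Definition affine_arrangement (R : realType) (m d : nat)
    (l : 'I_d -> {mpoly R[i][m]}) : Prop :=
  (forall i, mpoly.msize (l i) = 2%N) /\
  injective (fun i => zero_locus (l i)).

Definition essential (R : realType) (m d : nat)
    (l : 'I_d -> {mpoly R[i][m]}) : Prop :=
  exists (I : {set 'I_d}) (p : 'rV[R[i]]_m),
    \bigcap_(i in [set i | i \in I]) zero_locus (l i) = [set p].

Definition grad (R : realType) (m : nat) (g : {mpoly R[i][m]})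
  (x : 'rV[R[i]]_m) : 'rV[R[i]]_m :=
  \row_(k < m) pval (mderiv k g) x.

Definition Mset (R : realType) (m : nat) (g : {mpoly R[i][m]}) :
  set 'rV[R[i]]_m :=
  [set x | exists c : R[i], grad g x = c *: map_mx conjc x].

Definition tame_on (R : realType) (m : nat) (g : {mpoly R[i][m]})
    (A : set 'rV[R[i]]_m) : Prop :=
  forall z : nat -> 'rV[R[i]]_m, (forall k, A (z k)) ->
    enorm (z k) @[k --> \oo] --> +oo ->
    cabs (pval g (z k)) @[k --> \oo] --> +oo.

Definition M_tame (R : realType) (m : nat) (g : {mpoly R[i][m]}) : Prop :=
  tame_on g (Mset g).

(* X is meant to be the zero locus of g. *)
Definition M0_tame (R : realType) (m : nat) (X : set 'rV[R[i]]_m)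
    (g : {mpoly R[i][m]}) : Prop :=
  tame_on g (Mset g `\` X).

(* Main.v *)
Require Import Defs.
From HB Require Import structures.
From mathcomp Require Import all_boot all_order all_algebra.
From mathcomp Require Import complex.
From mathcomp Require Import boolp classical_sets reals topology normedtype.
From mathcomp Require Import -(notations) mpoly.
From mathcomp Require Import ring lra.

Import Order.TTheory GRing.Theory Num.Theory.
Import numFieldNormedType.Exports.

Local Open Scope classical_set_scope.
Local Open Scope ring_scope.
Local Open Scope complex_scope.

(* Write y_i for the value of the i-th affine form at x.  Off X, membership of x
   in M(f_e) says that sum_i e_i a_i / y_i is a multiple c of conj(x), where a_i
   is the linear part of the i-th form.  Suppose that at such a point, far away,
   exactly the y_i with i in a nonempty S are small.  These forms have a common
   zero p, and pairing with x - p gives c = O(1/|x|^2).  There is also a small u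
   with a_i.u = y_i on S, and pairing with u gives
   sum_(i in S) e_i = O(|u|), which is absurd.  Hence all the y_i stay away from
   0, while one of them tends to infinity because the arrangement is essential.
   In the plane, far points of X lie on a single line, where membership in M(f)
   forces x to be the foot of the perpendicular from the origin. *)

(** * Modulus and Euclidean norm estimates *)

Section Cabs.
Set Implicit Arguments.
Unset Strict Implicit.
Variable R : realType.
Implicit Types (z w : R[i]).

(** Transfers facts about the norm with values in [R[i]] to the real-valued modulus. *)
Lemma cabs_normr z : (cabs z)%:C = `|z|. Proof. by []. Qed.

Lemma cabs_ge0 z : 0 <= cabs z.
Proof. by rewrite -ler0c cabs_normr. Qed.

Lemma cabs0 : cabs (0 : R[i]) = 0. Proof. exact: Normc.normc0. Qed.

Lemma cabs1 : cabs (1 : R[i]) = 1. Proof. exact: Normc.normc1. Qed.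

Lemma cabsM z w : cabs (z * w) = cabs z * cabs w.
Proof. exact: Normc.normcM. Qed.

Lemma cabsV z : cabs z^-1 = (cabs z)^-1.
Proof. exact: Normc.normcV. Qed.

Lemma cabsX z k : cabs (z ^+ k) = cabs z ^+ k.
Proof. by elim: k => [|k IH]; rewrite ?cabs1 // !exprS cabsM IH. Qed.

Lemma cabsD z w : cabs (z + w) <= cabs z + cabs w.
Proof. by rewrite -lecR rmorphD /= !cabs_normr ler_normD. Qed.

Lemma cabsN z : cabs (- z) = cabs z.
Proof. by apply: (@complexI R); rewrite !cabs_normr normrN. Qed.

Lemma cabs_nat k : cabs (k%:R : R[i]) = k%:R.
Proof. by apply: (@complexI R); rewrite !cabs_normr normr_nat rmorph_nat. Qed.

Lemma cabs_real (r : R) : 0 <= r -> cabs r%:C = r.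
Proof.
by move=> r0; apply: (@complexI R); rewrite cabs_normr ger0_norm ?ler0c.
Qed.

Lemma cabs_conj z : cabs z^* = cabs z.
Proof. by apply: (@complexI R); rewrite !cabs_normr normcJ. Qed.

Lemma cabs_gt0 z : (0 < cabs z) = (z != 0).
Proof. by rewrite -ltcR cabs_normr normr_gt0. Qed.

Lemma mulz_conj z : z * z^* = (cabs z ^+ 2)%:C.
Proof. by rewrite rmorphXn /= cabs_normr sqr_normc. Qed.

Lemma cabs_sum (I : finType) (P : pred I) (F : I -> R[i]) :
  cabs (\sum_(i | P i) F i) <= \sum_(i | P i) cabs (F i).
Proof.
elim/big_rec2: _ => [|i y x _ IH]; first by rewrite cabs0.
by rewrite (le_trans (cabsD _ _)) // lerD2l.
Qed.

Lemma cabs_prod (I : finType) (F : I -> R[i]) :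
  cabs (\prod_i F i) = \prod_i cabs (F i).
Proof. by apply: big_morph; [exact: cabsM | exact: cabs1]. Qed.

Lemma ler_cabs_total {I : finType} (F : I -> R[i]) i :
  cabs (F i) <= \sum_j cabs (F j).
Proof. by rewrite (bigD1 i) //= lerDl sumr_ge0 // => j _; exact: cabs_ge0. Qed.

Lemma ler_sum_const (m : nat) (F : 'I_m -> R) B :
  (forall k, F k <= B) -> \sum_k F k <= m%:R * B.
Proof.
by move=> FB; rewrite mulr_natl -[m in leRHS]card_ord -sumr_const ler_sum.
Qed.

Section Enorm.
Variable m : nat.
Implicit Types (x u : 'rV[R[i]]_m).

Lemma enorm_ge0 x : 0 <= enorm x. Proof. exact: sqrtr_ge0. Qed.

Lemma sqr_enorm x : (enorm x ^+ 2)%:C = \sum_k x 0 k * (x 0 k)^*.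
Proof.
rewrite sqr_sqrtr ?sumr_ge0 // => [|k _]; last exact: sqr_ge0.
by rewrite rmorph_sum; apply: eq_bigr => k _; rewrite mulz_conj.
Qed.

Lemma cabs_le_enorm x k : cabs (x 0 k) <= enorm x.
Proof.
rewrite -(@ler_pXn2r _ 2) ?nnegrE ?cabs_ge0 ?enorm_ge0 //.
rewrite sqr_sqrtr ?sumr_ge0 // => [|j _]; last exact: sqr_ge0.
by rewrite (bigD1 k) //= lerDl sumr_ge0 // => j _; exact: sqr_ge0.
Qed.

Lemma enorm_le_sum x : enorm x <= \sum_k cabs (x 0 k).
Proof.
have s0 : 0 <= \sum_k cabs (x 0 k) by apply: sumr_ge0 => k _; exact: cabs_ge0.
rewrite -(@ler_pXn2r _ 2) ?nnegrE ?enorm_ge0 //.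
rewrite sqr_sqrtr ?sumr_ge0 // => [|j _]; last exact: sqr_ge0.
rewrite expr2 mulr_suml; apply: ler_sum => k _.
by rewrite expr2 ler_wpM2l ?cabs_ge0 // (ler_cabs_total (fun k => x 0 k)).
Qed.

Lemma enorm_le x B : (forall k, cabs (x 0 k) <= B) -> enorm x <= m%:R * B.
Proof.
by move=> xB; exact: le_trans (enorm_le_sum x) (ler_sum_const xB).
Qed.

Lemma cabs_pairing_le x u B : 0 <= B -> (forall k, cabs (u 0 k) <= B) ->
  cabs (\sum_k u 0 k * (x 0 k)^*) <= m%:R * (B * enorm x).
Proof.
move=> B0 uB; apply: (le_trans (cabs_sum _ _)).
apply: ler_sum_const => k.
by rewrite cabsM cabs_conj ler_pM ?cabs_ge0 ?cabs_le_enorm.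
Qed.

End Enorm.

Lemma cabs_mulmx_le {m d : nat} (u : 'rV[R[i]]_m)
    (A : 'M[R[i]]_(m, d)) (B : R) i :
  (forall k, cabs (u 0 k) <= B) ->
  cabs ((u *m A) 0 i) <= B * \sum_k \sum_j cabs (A k j).
Proof.
move=> uB; rewrite mxE; apply: (le_trans (cabs_sum _ _)).
rewrite mulr_sumr; apply: ler_sum => k _; rewrite cabsM.
by rewrite ler_pM ?cabs_ge0 // (ler_cabs_total (fun j => A k j)).
Qed.

End Cabs.

(** * Lower bounds for the affine forms at distant critical points *)

Section Crit.
Set Implicit Arguments.
Unset Strict Implicit.
Variables (R : realType) (m d : nat).
Implicit Types (A : 'M[R[i]]_(m, d)) (b : 'rV[R[i]]_d) (x u : 'rV[R[i]]_m).

(* The values approach 0 only if the affine system x A + b = 0 is consistent. *)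
Lemma affine_small_or_bounded_below A b :
  (exists2 delta : R, 0 < delta &
    forall x, exists i, delta <= cabs ((x *m A + b) 0 i)) \/
  (exists2 C : R, 0 <= C &
    forall x eps, (forall i, cabs ((x *m A + b) 0 i) <= eps) ->
    exists2 u, u *m A = x *m A + b & forall k, cabs (u 0 k) <= C * eps).
Proof.
(* [b <= A] puts [b] in the row space of [A], so that the system is solvable. The pseudo-inverse
   then produces [u] from the values, and [C] is the sum of the moduli of its entries. *)
have [bA|bA] := boolP (b <= A)%MS; [right|left].
  exists (\sum_k \sum_j cabs (pinvmx A k j)).
    by do 2![apply: sumr_ge0 => ? _]; exact: cabs_ge0.
  move=> x eps small; exists ((x *m A + b) *m pinvmx A).
    by rewrite mulmxKpV // addmx_sub ?submxMl.
  by move=> k; rewrite mulrC cabs_mulmx_le.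
(* Some column of the cokernel matrix kills [A] but not [b], so [x *m A + b] has the same nonzero
   image under it for every [x]. This image would be too small if all the values were. *)
have [i0 [j bj]] : exists i j, (b *m cokermx A) i j != 0.
  by apply/matrix0Pn; rewrite -submxE.
rewrite (ord1 i0) in bj.
set N := \sum_k \sum_j cabs (cokermx A k j).
have N0 : 0 <= N by do 2![apply: sumr_ge0 => ? _]; exact: cabs_ge0.
have N1 : 0 < N + 1 by rewrite ltr_wpDl.
exists (cabs ((b *m cokermx A) 0 j) / (N + 1)).
  by rewrite divr_gt0 // cabs_gt0.
move=> x; apply: contrapT => /forallNP small.
have /(cabs_mulmx_le (cokermx A) j) : forall i, cabs ((x *m A + b) 0 i)
    <= cabs ((b *m cokermx A) 0 j) / (N + 1).
  by move=> i; rewrite leNgt; apply/negP => /ltW /small.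
rewrite mulmxDl -mulmxA mulmx_coker mulmx0 add0r -/N leNgt => /negP; apply.
by rewrite -mulrA gtr_pMr ?cabs_gt0 // mulrC ltr_pdivrMr // mul1r ltrDl.
Qed.

(** The gradient equation of f_e divided by f_e(x): column i of [A] is the linear part of the i-th
    form, and [c] is the multiplier over f_e(x). It has this meaning only where no form vanishes,
    since division by 0 gives 0. *)
Definition critical (e : 'I_d -> nat) A b x (c : R[i]) :=
  forall k, \sum_i (e i)%:R * (A k i / (x *m A + b) 0 i) = c * (x 0 k)^*.

Lemma critical_pairing e A b x c u : critical e A b x c ->
  \sum_i (e i)%:R * ((u *m A) 0 i / (x *m A + b) 0 i) =
  c * \sum_k u 0 k * (x 0 k)^*.
Proof.
move=> crit; under eq_bigr do rewrite [(u *m A) 0 _]mxE mulr_suml mulr_sumr.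
rewrite exchange_big mulr_sumr; apply: eq_bigr => k _ /=.
rewrite mulrCA -crit mulr_sumr; apply: eq_bigr => i _.
by rewrite -mulrA mulrCA.
Qed.

(** Pairing with [x - p] bounds c(|x|^2 - q), where q pairs [p] with conj(x) and grows only linearly
    in |x|. [K] is both the threshold for |x| and the final bound. *)
Lemma critical_coef_bound e A b (S : {set 'I_d}) p (delta : R) :
  0 < delta -> (forall i, i \in S -> (p *m A + b) 0 i = 0) ->
  exists2 K : R, 0 <= K &
  forall x c, K <= enorm x -> critical e A b x c ->
    (forall i, (x *m A + b) 0 i != 0) ->
    (forall i, i \notin S -> delta <= cabs ((x *m A + b) 0 i)) ->
    cabs c * enorm x ^+ 2 <= K.
Proof.
move=> delta0 p0.
set P := \sum_k cabs (p 0 k).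
set L := \sum_i cabs ((p *m A + b) 0 i).
set E := \sum_i (e i)%:R : R.
have P0 : 0 <= P by apply: sumr_ge0 => ? _; exact: cabs_ge0.
have L0 : 0 <= L by apply: sumr_ge0 => ? _; exact: cabs_ge0.
have E0 : 0 <= E by apply: sumr_ge0 => ? _; exact: ler0n.
have Ld : 0 <= L / delta by rewrite divr_ge0 // ltW.
pose C := E * (1 + L / delta).
have C0 : 0 <= C by rewrite mulr_ge0 // addr_ge0.
have mP0 : 0 <= m%:R * P by rewrite mulr_ge0.
have C2 : 0 <= C * 2 by rewrite mulr_ge0.
(* The first summand forces |q| <= |x|^2 / 2; the second is twice the bound [C] on |c(|x|^2 -
   q)|. *)
exists (m%:R * P * 2 + C * 2); first by rewrite addr_ge0 // mulr_ge0.
move=> x c xK crit y0 yS.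
have xP : m%:R * P * 2 <= enorm x by apply: le_trans xK; rewrite lerDl.
(* The left side is sum_i e_i (1 - y_i(p) / y_i(x)), bounded since y_i(p)
   vanishes on S. *)
have := critical_pairing (x - p) crit.
have -> : \sum_k (x - p) 0 k * (x 0 k)^* =
    (enorm x ^+ 2)%:C - \sum_k p 0 k * (x 0 k)^*.
  by rewrite sqr_enorm -sumrB; apply: eq_bigr => k _; rewrite !mxE mulrBl.
set q := \sum_k p 0 k * _ => eqc.
have qle : cabs q <= m%:R * (P * enorm x).
  by apply: cabs_pairing_le => // k; exact: (ler_cabs_total (fun k => p 0 k)).
have lhs : cabs (c * ((enorm x ^+ 2)%:C - q)) <= C.
  rewrite -eqc; apply: (le_trans (cabs_sum _ _)); rewrite /C mulr_suml.
  apply: ler_sum => i _; rewrite cabsM cabs_nat ler_wpM2l //.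
  have -> : ((x - p) *m A) 0 i / (x *m A + b) 0 i =
      1 - (p *m A + b) 0 i / (x *m A + b) 0 i.
    rewrite -(divff (y0 i)) -mulrBl; congr (_ / _).
    by rewrite mulmxBl !mxE; ring.
  apply: (le_trans (cabsD _ _)); rewrite cabs1 cabsN lerD2l.
  have [iS|iS] := boolP (i \in S); first by rewrite p0 // mul0r cabs0.
  rewrite cabsM cabsV ler_pM ?cabs_ge0 ?invr_ge0 ?cabs_ge0 //.
    exact: (ler_cabs_total (fun i => (p *m A + b) 0 i)).
  by rewrite lef_pV2 ?posrE ?yS // cabs_gt0.
have xx : enorm x ^+ 2 / 2 <= cabs ((enorm x ^+ 2)%:C - q).
  have : enorm x ^+ 2 <= cabs ((enorm x ^+ 2)%:C - q) + cabs q.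
    have := cabsD ((enorm x ^+ 2)%:C - q) q.
    by rewrite subrK cabs_real ?sqr_ge0.
  have : m%:R * P * 2 * enorm x <= enorm x ^+ 2.
    by rewrite expr2 ler_wpM2r // enorm_ge0.
  by lra.
have := ler_wpM2l (cabs_ge0 c) xx; rewrite cabsM in lhs.
by lra.
Qed.

Lemma critical_not_all_small e A b (S : {set 'I_d}) i0 (delta : R) :
  i0 \in S -> (0 < e i0)%N -> 0 < delta ->
  exists2 r : R, 0 < r &
  forall x c, r <= enorm x -> critical e A b x c ->
    (forall i, (x *m A + b) 0 i != 0) ->
    (forall i, i \notin S -> delta <= cabs ((x *m A + b) 0 i)) ->
    exists2 i, i \in S & r^-1 <= cabs ((x *m A + b) 0 i).
Proof.
move=> i0S ei0 delta0.
(* Zeroing the columns outside [S] makes the dichotomy speak of the forms in [S] only. *)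
pose AS : 'M[R[i]]_(m, d) := \matrix_(k, i) if i \in S then A k i else 0.
pose bS : 'rV[R[i]]_d := \row_i if i \in S then b 0 i else 0.
have ASE u i : (u *m AS) 0 i = if i \in S then (u *m A) 0 i else 0.
  rewrite !mxE; case: ifP => iS; last first.
    by rewrite big1 // => k _; rewrite mxE iS mulr0.
  by apply: eq_bigr => k _; rewrite mxE iS.
have yE x i : (x *m AS + bS) 0 i = if i \in S then (x *m A + b) 0 i else 0.
  by rewrite mxE ASE [bS _ _]mxE [in RHS]mxE; case: ifP; rewrite ?addr0.
have [[eta eta0 big]|[C C0 small]] := affine_small_or_bounded_below AS bS.
  exists eta^-1; first by rewrite invr_gt0.
  move=> x c _ _ _ _; have [k] := big x; rewrite yE invrK.
  by case: ifP => [kS ?|_]; [exists k | rewrite cabs0 leNgt eta0].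
(* Taking x = 0 and, as eps, the total of the moduli gives [u0] with [u0 *m AS = bS]; hence [- u0]
   is a common zero of the forms in [S]. *)
have [u0 u0E _] := small 0 _ (ler_cabs_total (fun i => (0 *m AS + bS) 0 i)).
have pS i : i \in S -> (- u0 *m A + b) 0 i = 0.
  move=> iS; have := yE (- u0) i; rewrite iS => <-.
  by rewrite mulNmx u0E mul0mx add0r addNr mxE.
have [K K0 cK] := critical_coef_bound e delta0 pS.
set a := \sum_k \sum_j cabs (A k j).
set E := \sum_i (e i)%:R : R.
have a0 : 0 <= a by do 2![apply: sumr_ge0 => ? _]; exact: cabs_ge0.
have E0 : 0 <= E by apply: sumr_ge0 => ? _; exact: ler0n.
(* With coordinates of [u] at most C / r, the terms outside [S] and the right-hand side of the
   pairing total at most D / r. Taking r = 1 + K + D makes this less than 1. *)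
pose D := E * (C * a / delta) + K * m%:R * C.
have D0 : 0 <= D.
  by rewrite addr_ge0 // mulr_ge0 // ?divr_ge0 ?mulr_ge0 // ltW.
exists (1 + K + D); first by rewrite -addrA ltr_pwDl // addr_ge0.
set r := 1 + K + D => x c xr crit y0 yS.
have r0 : 0 < r by rewrite /r -addrA ltr_pwDl // addr_ge0.
have x1 : 1 <= enorm x by apply: le_trans xr; rewrite /r -addrA lerDl addr_ge0.
have xK : K <= enorm x.
  by apply: le_trans xr; rewrite /r addrAC lerDr addr_ge0.
apply: contrapT => noti.
have [i|u uE uC] := small x r^-1.
  rewrite yE; case: ifP => iS; last by rewrite cabs0 invr_ge0 ltW.
  by rewrite leNgt; apply/negP => /ltW h; apply: noti; exists i.
have := critical_pairing u crit; rewrite (bigID (mem S)) /=.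
set w := \sum_(i | i \notin S) _.
(* On [S] the vector [u] reproduces the values of the forms, so every quotient is 1 and a positive
   integer remains. *)
have -> : \sum_(i in S) (e i)%:R * ((u *m A) 0 i / (x *m A + b) 0 i) =
    (\sum_(i in S) e i)%:R.
  rewrite natr_sum; apply: eq_bigr => i iS.
  have := ASE u i; rewrite iS uE yE iS => <-.
  by rewrite divff ?mulr1.
move=> eqS.
have one : 1 <= cabs ((\sum_(i in S) e i)%:R : R[i]).
  by rewrite cabs_nat ler1n (bigD1 i0) //= addn_gt0 ei0.
have Cr0 : 0 <= C * r^-1 by rewrite mulr_ge0 ?invr_ge0 // ltW.
have wle : cabs w <= E * (C * r^-1 * a / delta).
  apply: (le_trans (cabs_sum _ _)).
  apply: (@le_trans _ _
    (\sum_(i | i \notin S) (e i)%:R * (C * r^-1 * a / delta))).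
    apply: ler_sum => i iS; rewrite cabsM cabs_nat ler_wpM2l // cabsM cabsV.
    rewrite ler_pM ?cabs_ge0 ?invr_ge0 ?cabs_ge0 //.
      exact: cabs_mulmx_le.
    by rewrite lef_pV2 ?posrE ?yS // cabs_gt0.
  rewrite -mulr_suml ler_wpM2r //.
    by rewrite divr_ge0 ?mulr_ge0 ?invr_ge0 // ltW.
  by rewrite /E [leRHS](bigID (mem S)) /= lerDr sumr_ge0.
(* Since |x| >= 1, |c| |x| is at most |c| |x|^2, hence at most [K]. *)
have cle : cabs (c * \sum_k u 0 k * (x 0 k)^*) <= K * m%:R * (C * r^-1).
  rewrite cabsM; have := cK x c xK crit y0 yS => cx.
  have := cabs_pairing_le x Cr0 uC => ux.
  apply: (le_trans (ler_wpM2l (cabs_ge0 c) ux)).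
  have -> : cabs c * (m%:R * (C * r^-1 * enorm x)) =
     cabs c * enorm x * (m%:R * (C * r^-1)) by ring.
  have mCr : 0 <= m%:R * (C * r^-1) by rewrite mulr_ge0.
  rewrite -[leRHS]mulrA ler_wpM2r //; apply: le_trans cx.
  by rewrite ler_wpM2l ?cabs_ge0 // expr2 ler_peMl // enorm_ge0.
have : 1 <= cabs w + cabs (c * \sum_k u 0 k * (x 0 k)^*).
  apply: (le_trans one); rewrite -eqS; set V := (\sum_(i in S) e i)%:R.
  by have := cabsD (- w) (V + w); rewrite addrCA addNr addr0 cabsN.
have : E * (C * r^-1 * a / delta) + K * m%:R * (C * r^-1) = D / r.
  by rewrite /D; ring.
have : D / r < 1 by rewrite ltr_pdivrMr // mul1r /r ltrDr ltr_pwDl.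
by lra.
Qed.

Lemma critical_bounded_below e A b : (forall i, (0 < e i)%N) ->
  exists2 r : R, 0 < r & forall x c, r <= enorm x -> critical e A b x c ->
    (forall i, (x *m A + b) 0 i != 0) ->
    forall i, r^-1 <= cabs ((x *m A + b) 0 i).
Proof.
move=> e0.
pose Q (S : {set 'I_d}) r := 0 < r /\ forall x c, r <= enorm x ->
  critical e A b x c -> (forall i, (x *m A + b) 0 i != 0) ->
  exists2 i, i \in S & r^-1 <= cabs ((x *m A + b) 0 i).
(* [Q S r] persists when [r] grows, so finitely many thresholds can be merged into one; 0 is a
   filler where [P] fails. *)
have common (P : 'I_d -> bool) (F : 'I_d -> {set 'I_d}) :
    (forall i, P i -> exists r, Q (F i) r) ->
    exists2 r, 0 < r & forall i, P i -> Q (F i) r.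
  move=> QF; have /choice[g gQ] : forall i, exists r, P i -> Q (F i) r.
    by move=> i; have [/QF[r]|] := boolP (P i); [exists r | exists 0].
  have s0 : 0 <= \sum_i `|g i| by exact: sumr_ge0.
  exists (1 + \sum_i `|g i|) => [|i Pi]; first by rewrite ltr_pwDl.
  have [g0 gi] := gQ i Pi; have gs : g i <= 1 + \sum_i `|g i|.
    rewrite (le_trans (ler_norm _)) // (bigD1 i) //= addrCA lerDl.
    by rewrite addr_ge0 // sumr_ge0.
  split=> [|x c xr crit y0]; first by rewrite ltr_pwDl.
  have [j jF gj] := gi x c (le_trans gs xr) crit y0.
  by exists j => //; apply: le_trans gj; rewrite lef_pV2 ?posrE // ltr_pwDl.
(* Descending induction on S: the bound for the sets i |: S, with i outside S,
   is the threshold for the forms outside S. *)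
have QS (k : nat) : forall (S : {set 'I_d}) i0, i0 \in S ->
    (#|~: S| <= k)%N -> exists r, Q S r.
  elim: k => [|k IH] S i0 i0S Sk.
    (* Here [S] contains every index, so any positive threshold outside [S] will do. *)
    have [r r0 rP] := critical_not_all_small A b i0S (e0 i0) ltr01.
    exists r; split => // x c xr crit y0; apply: (rP x c) => // i iS.
    by move: Sk; rewrite leqn0 cards_eq0 => /eqP/setP/(_ i); rewrite !inE iS.
  have [|s s0 sQ] := common (fun i => i \notin S) (fun i => i |: S).
    move=> i iS; apply: (IH _ i0); first by rewrite inE i0S orbT.
    rewrite -ltnS; apply: leq_trans Sk; apply: proper_card.
    apply/properP; split; first by rewrite finset.setCS finset.subsetUr.
    by exists i; rewrite !inE ?iS ?eqxx.
  have [|r r0 rP] := critical_not_all_small A b (delta := s^-1) i0S (e0 i0).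
    by rewrite invr_gt0.
  have rs0 : 0 < r + s by rewrite addr_gt0.
  exists (r + s); split=> // x c xrs crit y0.
  have xr : r <= enorm x by rewrite (le_trans _ xrs) // lerDl ltW.
  have xs : s <= enorm x by rewrite (le_trans _ xrs) // lerDr ltW.
  apply: contrapT => noti.
  (* For i outside [S], the set [i |: S] supplies a form that is not small. If it lies in [S] the
     claim holds already, so it is the i-th one. *)
  have [i iS|i iS ri] := rP x c xr crit y0.
    have [_ /(_ x c xs crit y0)[j]] := sQ i iS; rewrite !inE.
    case/orP => [/eqP->//|jS sj]; case: noti; exists j => //.
    by apply: le_trans sj; rewrite lef_pV2 ?posrE // lerDr ltW.
  case: noti; exists i => //.
  by apply: le_trans ri; rewrite lef_pV2 ?posrE // lerDl ltW.
(* On singletons, the existence of a form that is not small becomes a bound for each form. *)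
have [|r r0 rQ] := common xpredT (fun i => [set i]%SET).
  by move=> i _; apply: (QS _ _ i _ (leqnn _)); rewrite inE.
exists r => // x c xr crit y0 i.
by have [_ /(_ x c xr crit y0)[j]] := rQ i isT; rewrite inE => /eqP->.
Qed.

End Crit.

(** * Values and derivatives of affine forms and their products *)

Section Polynomials.
Set Implicit Arguments.
Unset Strict Implicit.
Variables (R : realType) (m d : nat).
Implicit Types (x : 'rV[R[i]]_m) (l : 'I_d -> {mpoly R[i][m]}).

Lemma mpoly_affineE (p : {mpoly R[i][m]}) : (mpoly.msize p <= 2)%N ->
  p = mpolyC m (mcoeff mnm0 p)
      + \sum_k mcoeff (mnm1 k) p *: mpolyX (R[i]) (mnm1 k).
Proof.
move=> p2; apply/mpolyP => q; rewrite mcoeffD mcoeffC raddf_sum /=.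
under eq_bigr do rewrite mcoeffZ mcoeffX.
have [q0|q1|q2] := ltngtP (mdeg q) 1.
- have /eqP-> : q == mnm0 by rewrite -mdeg_eq0 -leqn0 -ltnS.
  rewrite eqxx mulr1 big1 ?addr0 // => k _.
  by rewrite -mdeg_eq0 mdeg1 mulr0.
- rewrite memN_msupp_eq0; last by rewrite msize_mdeg_ge ?(leq_trans p2).
  rewrite -mdeg_eq0 big1 ?addr0 => [|k _].
    by case: mdeg q1 => // ? _; rewrite mulr0.
  by case: eqP => [qk|_]; [rewrite -qk mdeg1 in q1 | rewrite mulr0].
- have /existsP[k /eqP->] : [exists i, q == mnm1 i] by rewrite -mdeg_eq1 q2.
  rewrite -mdeg_eq0 mdeg1 mulr0 add0r (bigD1 k) //= eqxx mulr1.
  rewrite big1 ?addr0 // => j jk.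
  case: eqP => [/mnmP/(_ j)|_]; last by rewrite mulr0.
  by rewrite !mnm1E eqxx eq_sym (negPf jk).
Qed.

Definition linear_coefs l : 'M[R[i]]_(m, d) :=
  \matrix_(k, i) mcoeff (mnm1 k) (l i).

Definition constant_coefs l : 'rV[R[i]]_d := \row_i mcoeff mnm0 (l i).

Lemma pval_affine l x i : (mpoly.msize (l i) <= 2)%N ->
  pval (l i) x = (x *m linear_coefs l + constant_coefs l) 0 i.
Proof.
move=> l2; rewrite /pval [in LHS](mpoly_affineE l2) mevalD mevalC !mxE addrC.
congr (_ + _); rewrite raddf_sum; apply: eq_bigr => k _ /=.
by rewrite mevalZ mevalXU mxE mulrC.
Qed.

Lemma pval_mderiv_affine l x i k : (mpoly.msize (l i) <= 2)%N ->
  pval (mderiv k (l i)) x = linear_coefs l k i.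
Proof.
move=> l2; rewrite /pval [in LHS](mpoly_affineE l2) mderivD mderivC add0r.
rewrite (big_morph _ (mderivD k) (mderiv0 _ k)).
rewrite (big_morph _ (mevalD (x 0)) (meval0 (x 0))) (bigD1 k) //.
rewrite mderivZ mderivX mnm1E eqxx scale1r.
have -> : mnm_sub (mnm1 k) (mnm1 k) = mnm0 .
  by apply/mnmP => j; rewrite mnmBE subnn mnmE.
rewrite big1 => [|j jk]; last first.
  by rewrite mderivZ mderivX mnm1E (negPf jk) scale0r scaler0 meval0.
by rewrite Monoid.mulm1 mevalZ mpolyX0 meval1 mulr1 mxE.
Qed.

(** Logarithmic derivatives add under products. Writing p' = p s instead of s = p' / p keeps the
    induction free of division. *)
Lemma pval_mderiv_prod l (e : 'I_d -> nat) (a : 'I_d -> R[i]) x k :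
  (forall i, pval (mderiv k (l i)) x = pval (l i) x * a i) ->
  pval (mderiv k (\prod_i l i ^+ e i)) x =
  pval (\prod_i l i ^+ e i) x * \sum_i (e i)%:R * a i.
Proof.
move=> la; rewrite /pval in la *.
have logdM (p q : {mpoly R[i][m]}) s t :
    meval (x 0) (mderiv k p) = meval (x 0) p * s ->
    meval (x 0) (mderiv k q) = meval (x 0) q * t ->
    meval (x 0) (mderiv k (p * q)) = meval (x 0) (p * q) * (s + t).
  by rewrite mderivM mevalD !mevalM => -> ->; ring.
elim/big_rec2: _ => [|i s p _ IH]; first by rewrite mulr0 mderivC meval0.
apply: (logdM) => //; elim: (e i) => [|j IHj].
  by rewrite expr0 mul0r mulr0 mderivC meval0.
by rewrite exprS -natr1 mulrDl mul1r addrC; exact: logdM.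
Qed.

End Polynomials.

(** * Growth of the product at critical points off the arrangement *)

Section Growth.
Set Implicit Arguments.
Unset Strict Implicit.
Variables (R : realType) (m d : nat) (l : 'I_d -> {mpoly R[i][m]}).
Implicit Types (x : 'rV[R[i]]_m).

Lemma tame_on_growth (g : {mpoly R[i][m]}) (A : set 'rV[R[i]]_m) :
  (forall B : R, exists r, forall x, A x -> r <= enorm x ->
     B <= cabs (pval g x)) ->
  tame_on g A.
Proof.
move=> grow z zA /cvgryPge zoo; apply/cvgryPge => B.
by have [r rP] := grow B; apply: filterS (zoo r) => k; exact: rP.
Qed.

Lemma pval_prod (e : 'I_d -> nat) (P : pred 'I_d) x :
  pval (\prod_(i | P i) l i ^+ e i) x = \prod_(i | P i) pval (l i) x ^+ e i.
Proof.
rewrite /pval (big_morph _ (mevalM (x 0)) (meval1 (x 0))).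
apply: eq_bigr => i _; elim: (e i) => [|k IH]; rewrite ?meval1 //.
by rewrite !exprS mevalM IH.
Qed.

Hypothesis l_affine : forall i, mpoly.msize (l i) = 2%N.

Local Notation y x := (x *m linear_coefs l + constant_coefs l).

Lemma pvalE x i : pval (l i) x = (y x) 0 i.
Proof. by rewrite pval_affine // l_affine. Qed.

Lemma Mset_critical (e : 'I_d -> nat) x :
  Mset (\prod_i l i ^+ e i) x -> (forall i, pval (l i) x != 0) ->
  exists c, critical e (linear_coefs l) (constant_coefs l) x c.
Proof.
move=> [c /rowP gradE] l0.
exists (c / pval (\prod_i l i ^+ e i) x) => k.
have f0 : pval (\prod_i l i ^+ e i) x != 0.
  by rewrite pval_prod; apply/prodf_neq0 => i _; rewrite expf_neq0.
apply: (mulfI f0); rewrite mulrA mulrCA divff // mulr1.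
have := gradE k; rewrite !mxE => <-.
have dl i : pval (mderiv k (l i)) x =
    pval (l i) x * (linear_coefs l k i / pval (l i) x).
  by rewrite mulrC divfK // pval_mderiv_affine ?l_affine.
rewrite (pval_mderiv_prod e dl).
by congr (_ * _); apply: eq_bigr => i _; rewrite pvalE.
Qed.

Lemma essential_growth : essential l ->
  forall B, exists r, forall x, r <= enorm x ->
    exists i, B <= cabs (pval (l i) x).
Proof.
move=> [I [p /seteqP[sub sup]]] B.
(* A vector killed by all linear parts would translate [p] inside the intersection, which is only
   [p]. Hence [x] can be recovered linearly from the values of the forms, and bounded values bound
   [x]. *)
have free : row_free (linear_coefs l).
  apply: inj_row_free => v v0; apply: (addrI p); rewrite addr0.
  apply: sub => i iI.
  have /= := sup p erefl i iI.
  by rewrite /zero_locus /= !pvalE mulmxDl v0 addr0.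
set N := \sum_k \sum_j cabs (pinvmx (linear_coefs l) k j).
set K := \sum_i cabs (constant_coefs l 0 i).
exists (m%:R * ((B + K) * N) + 1) => x xr; apply: contrapT => /forallNP small.
suff : enorm x <= m%:R * ((B + K) * N).
  by move=> /(le_trans xr); rewrite gerDl ler10.
apply: enorm_le => k.
have -> : x = (y x - constant_coefs l) *m pinvmx (linear_coefs l).
  by rewrite addrK mulmxKp.
apply: cabs_mulmx_le => i.
rewrite [(y x - _) _ _]mxE [(- constant_coefs l) _ _]mxE.
rewrite (le_trans (cabsD _ _)) // cabsN lerD //.
  by rewrite -pvalE leNgt; apply/negP => /ltW /small.
exact: (ler_cabs_total (fun i => constant_coefs l 0 i)).
Qed.

Lemma arrangement_growth (e : 'I_d -> nat) : essential l ->
  (forall i, (0 < e i)%N) -> forall B, exists r, forall x, r <= enorm x ->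
    Mset (\prod_i l i ^+ e i) x -> (forall i, pval (l i) x != 0) ->
    B <= cabs (pval (\prod_i l i ^+ e i) x).
Proof.
move=> ess e0 B.
have [r r0 rP] := critical_bounded_below (linear_coefs l) (constant_coefs l) e0.
(* At the index [i0] of a large form, one of its [e i0] copies supplies |B| / kappa and only
   [(e i0).-1] copies are bounded by [delta]; [delta <= 1] absorbs the missing power. *)
pose delta := Num.min 1 r^-1.
have delta0 : 0 < delta by rewrite lt_min ltr01 invr_gt0.
have delta1 : delta <= 1 by rewrite ge_min lexx.
pose kappa := \prod_i delta ^+ e i.
have kappa0 : 0 < kappa by apply: prodr_gt0 => i _; rewrite exprn_gt0.
have [s sP] := essential_growth ess (`|B| / kappa).
exists (r + `|s|) => x xrs critx l0.
have [c crit] := Mset_critical critx l0.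
have big i : delta <= cabs (pval (l i) x).
  rewrite pvalE; apply: (@le_trans _ _ r^-1); first by rewrite ge_min lexx orbT.
  apply: (rP x c) => // [|j]; last by rewrite -pvalE.
  by rewrite (le_trans _ xrs) // lerDl.
have [|i0 Bi0] := sP x.
  by rewrite (le_trans _ xrs) // (le_trans (ler_norm _)) // lerDr ltW.
rewrite pval_prod cabs_prod (le_trans (ler_norm B)) //.
apply: (@le_trans _ _ (kappa * cabs (pval (l i0) x))).
  by rewrite -ler_pdivrMl // mulrC.
rewrite /kappa (bigD1 i0) //= [leRHS](bigD1 i0) //= mulrAC.
rewrite ler_pM ?mulr_ge0 ?cabs_ge0 ?prodr_ge0 //.
- by rewrite exprn_ge0 // ltW.
- by move=> j _; rewrite exprn_ge0 // ltW.
- rewrite cabsX -(prednK (e0 i0)) exprSr [leRHS]exprSr ler_wpM2r ?cabs_ge0 //.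
  rewrite (@le_trans _ _ (delta ^+ (e i0).-1)) //.
    by rewrite ler_piMr // exprn_ge0 // ltW.
  by rewrite lerXn2r // nnegrE ?cabs_ge0 ?ltW.
apply: ler_prod => j _; rewrite cabsX exprn_ge0 /=; last exact: ltW.
by rewrite lerXn2r // nnegrE ?cabs_ge0 ?ltW.
Qed.

End Growth.

(** * The plane case: points of [Mset] lying on the lines *)

Section Plane.
Set Implicit Arguments.
Unset Strict Implicit.

Lemma linear_coefs_neq0 (R : realType) (m d : nat)
    (l : 'I_d -> {mpoly R[i][m]}) i :
  mpoly.msize (l i) = 2%N -> exists k, linear_coefs l k i != 0.
Proof.
move=> l2; apply: contrapT => /forallNP a0; move: (l2).
rewrite (mpoly_affineE (eq_leq l2)) big1 => [|k _].
  by rewrite addr0 msizeC; case: eqP.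
have := a0 k; rewrite mxE => /negP; rewrite negbK => /eqP ->.
by rewrite scale0r.
Qed.

(** In the plane, two vectors annihilated by a nonzero form are proportional: their determinant [D]
    vanishes, and then [w] is a multiple of the nonzero [t]. *)
Lemma plane_orthogonal_sub (F : fieldType) (t w : 'rV[F]_2) (a c : 'I_2 -> F) :
  t != 0 -> (exists k, a k != 0) ->
  \sum_k t 0 k * a k = 0 -> \sum_k t 0 k * c k = 0 ->
  \sum_k w 0 k * a k = 0 -> \sum_k w 0 k * c k = 0.
Proof.
move=> t0 [ka a0]; rewrite !big_ord_recl !big_ord0 !addr0 /=.
set k0 : 'I_2 := ord0; set k1 : 'I_2 := lift _ _ => ta tc wa.
have two (k : 'I_2) : k = k0 \/ k = k1.
  by case: k => [[|[|//]] ?]; [left|right]; apply: val_inj.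
pose D := t 0 k0 * w 0 k1 - t 0 k1 * w 0 k0.
have aD k : a k * D = 0.
  case: (two k) => ->; rewrite /D.
    transitivity (w 0 k1 * (t 0 k0 * a k0 + t 0 k1 * a k1)
      - t 0 k1 * (w 0 k0 * a k0 + w 0 k1 * a k1)); first by ring.
    by rewrite ta wa !mulr0 subr0.
  transitivity (t 0 k0 * (w 0 k0 * a k0 + w 0 k1 * a k1)
      - w 0 k0 * (t 0 k0 * a k0 + t 0 k1 * a k1)); first by ring.
  by rewrite ta wa !mulr0 subr0.
have {aD}D0 : D = 0 by have /eqP := aD ka; rewrite mulf_eq0 (negPf a0) => /eqP.
have tW k : t 0 k * (w 0 k0 * c k0 + w 0 k1 * c k1) = 0.
  case: (two k) => ->.
    transitivity (w 0 k0 * (t 0 k0 * c k0 + t 0 k1 * c k1) + D * c k1).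
      by rewrite /D; ring.
    by rewrite tc D0 mulr0 mul0r addr0.
  transitivity (w 0 k1 * (t 0 k0 * c k0 + t 0 k1 * c k1) - D * c k0).
    by rewrite /D; ring.
  by rewrite tc D0 mulr0 mul0r subr0.
have /matrix0Pn[i [k tk]] := t0; rewrite (ord1 i) in tk.
by have /eqP := tW k; rewrite mulf_eq0 (negPf tk) => /eqP.
Qed.

Variables (R : realType) (d : nat) (l : 'I_d -> {mpoly R[i][2]}).
Hypothesis l_arr : affine_arrangement l.

Let l_affine i : mpoly.msize (l i) = 2%N. Proof. exact: l_arr.1. Qed.

Lemma pval_sub (x z : 'rV[R[i]]_2) i :
  pval (l i) x - pval (l i) z = \sum_k (x - z) 0 k * linear_coefs l k i.
Proof.
have -> : \sum_k (x - z) 0 k * linear_coefs l k i =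
    ((x - z) *m linear_coefs l) 0 i.
  by rewrite mxE.
by rewrite !pvalE // mulmxBl !mxE; ring.
Qed.

Lemma line_inter_sub i j (x z : 'rV[R[i]]_2) : x != z ->
  pval (l i) x = 0 -> pval (l j) x = 0 ->
  pval (l i) z = 0 -> pval (l j) z = 0 ->
  zero_locus (l i) `<=` zero_locus (l j).
Proof.
move=> xz xi xj zi zj w; rewrite /zero_locus /= => wi.
have := pval_sub w x j; rewrite xj subr0 => ->.
apply: (@plane_orthogonal_sub _ (z - x) _ (fun k => linear_coefs l k i)).
- by rewrite subr_eq0 eq_sym.
- exact: linear_coefs_neq0.
- by rewrite -pval_sub zi xi subr0.
- by rewrite -pval_sub zj xj subr0.
- by rewrite -pval_sub wi xi subr0.
Qed.

(** Two common points would make the lines coincide, against injectivity of the zero loci; so the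
    single possible common point gives the bound. *)
Lemma line_inter_bounded i j : i != j -> exists r : R, forall x,
  pval (l i) x = 0 -> pval (l j) x = 0 -> enorm x <= r.
Proof.
move=> ij; have [[x [xi xj]]|none] :=
  pselect (exists x, pval (l i) x = 0 /\ pval (l j) x = 0).
  exists (enorm x) => z zi zj; have [-> //|xz] := eqVneq x z.
  case/negP: ij; apply/eqP/l_arr.2/seteqP.
  by split; apply: (@line_inter_sub _ _ x z).
by exists 0 => x xi xj; case: none; exists x.
Qed.

(** Each other line contributes at most one point. Elsewhere on the i-th line, this factor being
    simple, the gradient is a nonzero multiple [G] of its linear part; thus conj(x) is proportional
    to the linear part and x is the foot of the perpendicular from the origin. *)
Lemma Mset_line_bounded i : exists r : R, forall x,
  Mset (\prod_j l j) x -> pval (l i) x = 0 ->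
  enorm x <= r.
Proof.
have /choice[g gP] : forall j, exists r : R, i != j -> forall x,
    pval (l i) x = 0 -> pval (l j) x = 0 -> enorm x <= r.
  move=> j; have [_|/line_inter_bounded[r rP]] := eqVneq i j; first by exists 0.
  by exists r.
have [k ak] := linear_coefs_neq0 (l_affine i).
have ak0 : 0 < cabs (linear_coefs l k i) by rewrite cabs_gt0.
have g0 : 0 <= \sum_j `|g j| by exact: sumr_ge0.
(* The distance from the origin to the line is |b_i| / |a_i|; one nonzero coordinate of a_i in place
   of its norm gives an upper bound. *)
pose q := cabs (constant_coefs l 0 i) / cabs (linear_coefs l k i).
have q0 : 0 <= q by rewrite divr_ge0 ?cabs_ge0.
exists (q + \sum_j `|g j|) => x [c /rowP gradE] xi.
have [[j [ij xj]]|single] := pselect (exists j, i != j /\ pval (l j) x = 0).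
  rewrite (le_trans (gP j ij x xi xj)) // (le_trans (ler_norm _)) //.
  by rewrite (bigD1 j) //= addrCA lerDl addr_ge0 // sumr_ge0.
apply: (@le_trans _ _ q); last by rewrite lerDl.
set G := pval (\prod_(j | j != i) l j) x.
have G0 : G != 0.
  rewrite /G /pval (big_morph _ (mevalM (x 0)) (meval1 (x 0))).
  apply/prodf_neq0 => j ji; apply/eqP => xj.
  by apply: single; exists j; rewrite eq_sym.
have aG h : linear_coefs l h i * G = c * (x 0 h)^*.
  have <- : pval (mderiv h (\prod_j l j)) x = c * (x 0 h)^*.
    by have := gradE h; rewrite !mxE.
  rewrite (bigD1 i) //= /pval mderivM mevalD !mevalM.
  have -> : meval (x 0) (l i) = 0 by exact: xi.
  by rewrite mul0r addr0 -(pval_mderiv_affine x) ?l_affine.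
(* Pairing the gradient equation with [x] gives |x|^2 on the right, and on the line the linear part
   at [x] is minus the constant term. *)
have bG : cabs (constant_coefs l 0 i) * cabs G = cabs c * enorm x ^+ 2.
  rewrite -[enorm x ^+ 2]cabs_real ?sqr_ge0 // -!cabsM sqr_enorm mulr_sumr.
  under eq_bigr do rewrite mulrCA -aG mulrA.
  rewrite -mulr_suml cabsM [in RHS]cabsM; congr (_ * _).
  move: xi; rewrite pvalE // [X in X = _]mxE mxE => /eqP.
  by rewrite addrC addr_eq0 => /eqP ->; rewrite cabsN.
rewrite ler_pdivlMr //.
have [x0|x0] := eqVneq (enorm x) 0; first by rewrite x0 mul0r cabs_ge0.
have xgt : 0 < enorm x by rewrite lt_def x0 enorm_ge0.
rewrite -(ler_pM2r xgt) -(@ler_pM2r _ (cabs G)) ?cabs_gt0 //.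
have := congr1 (@cabs R) (aG k); rewrite !cabsM cabs_conj => aGk.
have -> : enorm x * cabs (linear_coefs l k i) * enorm x * cabs G =
    cabs c * enorm x ^+ 2 * cabs (x 0 k).
  transitivity (enorm x ^+ 2 * (cabs (linear_coefs l k i) * cabs G)).
    by ring.
  by rewrite aGk; ring.
by rewrite -bG [leRHS]mulrAC ler_wpM2l ?cabs_le_enorm // mulr_ge0 ?cabs_ge0.
Qed.

Lemma Mset_lines_bounded : exists r : R, forall x i,
  Mset (\prod_j l j) x -> pval (l i) x = 0 -> enorm x <= r.
Proof.
have /choice[g gP] := Mset_line_bounded.
exists (\sum_j `|g j|) => x i xM xi; apply: (le_trans (gP i x xM xi)).
by rewrite (le_trans (ler_norm _)) // (bigD1 i) //= lerDl sumr_ge0.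
Qed.

End Plane.

(** * Tameness from the growth estimates *)

Theorem theorem2p1 (R : realType) (n d : nat)
    (l : 'I_d -> {mpoly R[i][n.+1]}) (e : 'I_d -> nat)
    (hn : (1 <= n)%N)
    (harr : affine_arrangement l) (hess : essential l)
    (he : forall i, (0 < e i)%N)
    (hgcd : \big[gcdn/0%N]_(i < d) e i = 1%N) :
  let X := \bigcup_(i in [set: 'I_d]) zero_locus (l i) in
  let f := \prod_(i < d) l i in
  let fe := \prod_(i < d) l i ^+ e i in
  let de := (\sum_(i < d) e i)%N in
  (n = 1%N -> M_tame f) /\
  ((1 < n)%N \/ (n = 1%N /\ (d < de)%N) -> M0_tame X fe).
Proof.
move=> X f fe de; split=> [n1|_]; apply: tame_on_growth => B; last first.
  have [r rP] := arrangement_growth harr.1 hess he B.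
  exists r => x [xM xX] xr; apply: rP => // i; apply/eqP => xi.
  by apply: xX; exists i.
move: n1 l harr hess @X @f @fe {hn} => -> l harr hess X f fe.
(* f is f_e with all exponents 1. Beyond the bound [s] for points of [Mset] on the lines, no form
   vanishes and the growth estimate applies. *)
have [r rP] := arrangement_growth harr.1 hess (fun=> ltn0Sn 0) B.
have [s sP] := Mset_lines_bounded harr.
have fE : \prod_i l i ^+ 1 = f by apply: eq_bigr => i _; rewrite expr1.
rewrite fE in rP; exists (`|r| + `|s| + 1) => x xM xrs; apply: rP => //.
  by rewrite (le_trans _ xrs) // -addrA (le_trans (ler_norm _)) //
    lerDl addr_ge0.
move=> i; apply/eqP => /(sP x i xM) /(le_trans xrs).
rewrite leNgt => /negP; apply.
by rewrite addrAC (le_lt_trans (ler_norm s)) // ltrDr ltr_wpDl.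
Qed.
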